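(* Let $(X,d)$ be a complete metric space and let $f,g:X\to X$ be mappings such that $f(X)\subseteq g(X)$. Assume that $(f,g)$ is a generalized $\alpha$-$\psi$ contractive pair of mappings, with respect to functions $\alpha:X\times X\to[0,+\infty)$ and $\psi\in\Psi$, and that the following conditions hold: (i) $f$ is $\alpha$-admissible w.r.t. $g$; (ii) there exists $x_0\in X$ such that $\alpha(gx_0,fx_0)\ge 1$; (iii) if $\{gx_n\}$ is a sequence in $X$ (with $x_n \in X$) such that $\alpha(gx_n,gx_{n+1})\ge 1$ for all $n$ and $gx_n\to gz\in g(X)$ as $n\to\infty$, then there exists a subsequence $\{gx_{n(k)}\}$ of $\{gx_n\}$ such that $\alpha(gx_{n(k)},gz)\ge 1$ for all $k$. Also suppose that $g(X)$ is closed. Suppose in addition that for all $u,v\in C(g,f)$ there exists $w\in X$ such that $\alpha(gu,gw)\ge1$ and $\alpha(gv,gw)\ge1$, and that $f$ and $g$ commute at their coincidence points. Then $f$ and $g$ have a unique common fixed point, i.e. there is a unique $z\in X$ with $fz=gz=z$.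
   Context: $\Psi$ denotes the family of functions $\psi:[0,\infty)\to[0,\infty)$ that are nondecreasing and satisfy $\sum_{n=1}^{+\infty}\psi^n(t)<\infty$ for all $t>0$, where $\psi^n$ is the $n$-th iterate of $\psi$. Notation: $fx=f(x)$, $gx=g(x)$, and $C(g,f)=\{z\in X: gz=fz\}$ is the set of coincidence points of $g$ and $f$. ''$f$ and $g$ commute at their coincidence points'' means $f(g(x))=g(f(x))$ for all $x\in C(g,f)$. The pair $(f,g)$ is a generalized $\alpha$-$\psi$ contractive pair of mappings if there exist $\alpha:X\times X\to[0,+\infty)$ and $\psi\in\Psi$ such that for all $x,y\in X$, $\alpha(gx,gy)\,d(fx,fy)\le\psi(M(gx,gy))$, where $M(gx,gy)=\max\left\{d(gx,gy),\frac{d(gx,fx)+d(gy,fy)}{2},\frac{d(gx,fy)+d(gy,fx)}{2}\right\}$. $f$ is $\alpha$-admissible w.r.t. $g$ if for all $x,y\in X$: $\alpha(gx,gy)\ge1\Rightarrow\alpha(fx,fy)\ge1$. *)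

(* Defs.v *)
From HB Require Import structures.
From mathcomp Require Import all_boot all_order all_algebra.
From mathcomp Require Import boolp classical_sets reals topology normedtype sequences.

Set Implicit Arguments.
Unset Strict Implicit.
Unset Printing Implicit Defensive.

Import Order.TTheory GRing.Theory Num.Theory.
Import numFieldNormedType.Exports.

Local Open Scope classical_set_scope.
Local Open Scope ring_scope.

(* [completeType] additionally carries a chosen base point, hence this
   predicate on [metricType], which has none. *)
Definition complete_metric (R : realType) (X : metricType R) : Prop :=
  forall u : nat -> X, cauchy (u @ \oo) -> exists l : X, u @ \oo --> l.

(* A function [0, +oo[ -> [0, +oo[ is represented by [psi : R -> R]; its values
   at negative arguments are unconstrained and never used. *)
Definition Psi (R : realType) (psi : R -> R) : Prop :=
  [/\ forall t : R, 0 <= t -> 0 <= psi t,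
      forall s t : R, 0 <= s -> s <= t -> psi s <= psi t &
      forall t : R, 0 < t ->
        cvg ((fun N => \sum_(1 <= n < N) iter n psi t) @ \oo)].

(* M(gx, gy) depends on x and y themselves and not only on gx and gy, so it is
   taken as a function of x and y. *)
Definition maxdist (R : realType) (X : metricType R) (f g : X -> X)
    (x y : X) : R :=
  Num.max (mdist (g x) (g y))
    (Num.max ((mdist (g x) (f x) + mdist (g y) (f y)) / 2)
             ((mdist (g x) (f y) + mdist (g y) (f x)) / 2)).

Definition generalized_contractive_pair (R : realType) (X : metricType R)
    (f g : X -> X) (alpha : X -> X -> R) (psi : R -> R) : Prop :=
  forall x y, alpha (g x) (g y) * mdist (f x) (f y) <= psi (maxdist f g x y).

Definition admissible_wrt (R : realType) (X : Type) (alpha : X -> X -> R)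
    (f g : X -> X) : Prop :=
  forall x y, 1 <= alpha (g x) (g y) -> 1 <= alpha (f x) (f y).

Definition coincidence (X : Type) (g f : X -> X) : set X :=
  [set z | g z = f z].

(* Main.v *)
Require Import Defs.
From HB Require Import structures.
From mathcomp Require Import all_boot all_order all_algebra.
From mathcomp Require Import boolp classical_sets reals topology normedtype sequences.
From mathcomp Require Import lra.

Set Implicit Arguments.
Unset Strict Implicit.
Unset Printing Implicit Defensive.

Import Order.TTheory GRing.Theory Num.Theory.
Import numFieldNormedType.Exports.

Local Open Scope classical_set_scope.
Local Open Scope ring_scope.

(** An orbit of the pair is a sequence [x] with [g (x n.+1) = f (x n)]; it plays
    the part of Picard iteration and exists because the image of [f] lies in
    that of [g] ([jungck_orbit]). If consecutive terms satisfy
    [1 <= alpha (g (x n)) (g (x n.+1))], a condition that admissibility passes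
    from one index to the next, the contraction bounds each step by [psi] of the
    maximum of itself and the previous step. Since [psi t < t] for [t > 0]
    ([Psi_lt]), the current step can be dropped from the maximum
    ([Psi_drop_max]), and the steps are dominated by the iterates of [psi],
    which are summable. The sequence [g (x n)] is therefore Cauchy
    ([orbit_cauchy]). Its limit is some [g z], the image of [g] being closed,
    and [z] is a coincidence point ([orbit_limit_coincidence]): otherwise the
    distance from [g z] to [f z] would be at most about half of itself.

    The same estimate applies to the distances from [g u], for a coincidence
    point [u], to an orbit whose start is linked to [u] by [alpha]: such an
    orbit converges to [g u] ([orbit_cvg_coincidence]). Two coincidence points
    are linked to a common start [w], so by uniqueness of limits [g] takes a
    single value on all coincidence points. Commutation turns the value [g z]
    into a coincidence point, whose own value is again [g z]: it is a common
    fixed point. Any common fixed point is a coincidence point equal to its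
    value, hence is that one. *)

(** * Sequences *)

(** By the triangle inequality, the distance between two terms of the sequence
    is at most the difference of the corresponding partial sums of [b]. *)
Lemma cauchy_of_summable_steps (R : realType) (X : metricType R)
    (u : nat -> X) (b : nat -> R) :
  (forall n, mdist (u n) (u n.+1) <= b n) -> cvgn (series b) ->
  cauchy (u @ \oo).
Proof.
move=> ub /cvg_ex[/= L bL]; apply: cauchy_exP => e e0.
have e20 : 0 < e / 2 by rewrite divr_gt0.
have /cvgrPdist_lt/(_ _ e20)[N _ SN] := bL.
have tele n : (N <= n)%N -> mdist (u N) (u n) <= series b n - series b N.
  elim: n => [|n IHn]; first by rewrite leqn0 => /eqP ->; rewrite mdistxx subrr.
  rewrite leq_eqVlt => /predU1P[->|]; first by rewrite mdistxx subrr.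
  rewrite ltnS => /IHn le_n.
  rewrite (le_trans (metric_triangle _ (u n) _))// seriesSr.
  by have := ub n; lra.
exists (u N), N => // n /= Nn; rewrite ballEmdist /=.
have := SN _ Nn; have := SN _ (leqnn N); have := tele _ Nn.
by rewrite /= !ltr_norml; lra.
Qed.

Lemma increasing_seq_ge_id (n_ : nat -> nat) (k : nat) :
  increasing_seq n_ -> (k <= n_ k)%N.
Proof.
move=> /increasing_seqP incr; elim: k => // k IHk.
exact: leq_ltn_trans IHk (incr k).
Qed.

(** * Comparison functions with summable iterates *)

Lemma Psi_series_cvg (R : realType) (psi : R -> R) (t : R) :
  Psi psi -> 0 < t -> cvgn (series (fun n => iter n psi t)).
Proof. by case=> _ _ cv /cv; rewrite -(is_cvg_series_restrict 1). Qed.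

(** If [t <= psi t], monotonicity keeps every iterate above [t], whereas the
    terms of a convergent series tend to 0. *)
Lemma Psi_lt (R : realType) (psi : R -> R) (t : R) :
  Psi psi -> 0 < t -> psi t < t.
Proof.
move=> psiP t0; rewrite ltNge; apply/negP => t_le.
have ge_t n : t <= iter n psi t.
  elim: n => // n IHn; rewrite iterS (le_trans t_le)//.
  by case: psiP => _ + _; apply => //; exact: ltW.
have /cvgrPdist_lt/(_ t t0)[N _ /(_ N (leqnn N))] :=
  cvg_series_cvg_0 (Psi_series_cvg psiP t0).
by rewrite /= sub0r normrN ltNge (le_trans (ge_t N)) ?ler_norm.
Qed.

Lemma Psi_0 (R : realType) (psi : R -> R) : Psi psi -> psi 0 = 0.
Proof.
move=> psiP; have [psi_ge0 psi_mono _] := psiP.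
apply/eqP; rewrite eq_le psi_ge0// andbT leNgt; apply/negP => p0.
by have := Psi_lt psiP p0; rewrite ltNge psi_mono// psi_ge0.
Qed.

Lemma Psi_le (R : realType) (psi : R -> R) (t : R) :
  Psi psi -> 0 <= t -> psi t <= t.
Proof.
move=> psiP; rewrite le_eqVlt => /predU1P[<-|]; first by rewrite Psi_0.
by move=> /(Psi_lt psiP)/ltW.
Qed.

Lemma Psi_iter0 (R : realType) (psi : R -> R) (n : nat) :
  Psi psi -> iter n psi 0 = 0.
Proof. by move=> psiP; elim: n => // n IHn; rewrite iterS IHn Psi_0. Qed.

Lemma Psi_iter_summable (R : realType) (psi : R -> R) (t : R) :
  Psi psi -> 0 <= t -> cvgn (series (fun n => iter n psi t)).
Proof.
move=> psiP; rewrite le_eqVlt => /predU1P[<-|]; last exact: Psi_series_cvg.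
apply/cvg_ex; exists 0; apply: cvg_near_cst; apply: nearW => n.
by rewrite /series /= big1// => i _; rewrite Psi_iter0.
Qed.

(** If the maximum were [b > a], the hypothesis would read [b <= psi b], which
    [Psi_lt] excludes. This is how the term of index [n.+1] that [maxdist]
    brings into the bound on itself is discarded. *)
Lemma Psi_drop_max (R : realType) (psi : R -> R) (a b : R) :
  Psi psi -> 0 <= a -> b <= psi (Num.max a b) -> b <= psi a.
Proof.
move=> psiP a0; case: (leP b a) => // ab b_le.
have b0 : 0 < b by exact: le_lt_trans ab.
by have := lt_le_trans (Psi_lt psiP b0) b_le; rewrite ltxx.
Qed.

Lemma Psi_iter_bound (R : realType) (psi : R -> R) (a : nat -> R) :
  Psi psi -> (forall n, 0 <= a n) ->
  (forall n, a n.+1 <= psi (Num.max (a n) (a n.+1))) ->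
  forall n, a n <= iter n psi (a 0).
Proof.
move=> psiP a0 a_le; elim=> // n IHn; rewrite iterS.
apply: le_trans (Psi_drop_max psiP (a0 n) (a_le n)) _.
by case: psiP => _ + _; apply.
Qed.

(** * Orbits of a pair of maps and the contraction inequality *)

(** The substitute for the iterates of a single map: since the values of [f]
    are values of [g], each [f (x n)] can be lifted through [g]. *)
Lemma jungck_orbit (X : choiceType) (f g : X -> X) (x0 : X) :
  range f `<=` range g ->
  exists x : nat -> X, x 0 = x0 /\ forall n, g (x n.+1) = f (x n).
Proof.
move=> fg; have /choice[s sP] y : exists y', g y' = f y.
  by have [|y' _ <-] := fg (f y); [exists y | exists y'].
by exists (fun n => iter n s x0); split => // n; rewrite iterS sP.
Qed.

(** Where [alpha] is at least 1, the weight can be dropped from the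
    contraction inequality. *)
Lemma contract_admitted (R : realType) (X : metricType R) (f g : X -> X)
    (alpha : X -> X -> R) (psi : R -> R) (x y : X) :
  generalized_contractive_pair f g alpha psi ->
  1 <= alpha (g x) (g y) -> mdist (f x) (f y) <= psi (maxdist f g x y).
Proof.
move=> contr a1; apply: le_trans (contr x y).
by rewrite ler_peMl// mdist_ge0.
Qed.

Lemma half_sum_le_max (R : realType) (a b : R) :
  (a + b) / 2 <= Num.max a b.
Proof. by case: (leP a b) => ?; lra. Qed.

(** Along an orbit the second cross distance of [maxdist] vanishes and the
    first one is split by the triangle inequality, leaving averages of the two
    consecutive steps. *)
Lemma maxdist_step (R : realType) (X : metricType R) (f g : X -> X) (x y : X) :
  g y = f x ->
  maxdist f g x y <= Num.max (mdist (g x) (g y)) (mdist (g y) (f y)).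
Proof.
move=> gy; rewrite /maxdist -gy mdistxx addr0 !ge_max.
apply/and3P; split; [by rewrite le_max lexx | exact: half_sum_le_max | ].
apply: le_trans (half_sum_le_max _ _).
by rewrite ler_pM2r ?invr_gt0// metric_triangle.
Qed.

(** For an orbit [x], with [w := x n] and hence [f w = g (x n.+1)], the right-hand
    side is the maximum of the distances from [g u] to two consecutive terms of
    the orbit: the bound has the same shape as in [maxdist_step]. *)
Lemma maxdist_coincidence (R : realType) (X : metricType R) (f g : X -> X)
    (u w : X) :
  coincidence g f u ->
  maxdist f g u w <= Num.max (mdist (g u) (g w)) (mdist (g u) (f w)).
Proof.
move=> gfu; rewrite /maxdist -gfu mdistxx add0r (metric_sym (g w) (g u)) !ge_max.
apply/and3P; split; first by rewrite le_max lexx.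
  apply: le_trans (half_sum_le_max _ _).
  rewrite ler_pM2r ?invr_gt0// (metric_sym (g u) (g w)).
  exact: metric_triangle.
by rewrite addrC half_sum_le_max.
Qed.

Lemma orbit_cauchy (R : realType) (X : metricType R) (f g : X -> X)
    (alpha : X -> X -> R) (psi : R -> R) (x : nat -> X) :
  Psi psi -> generalized_contractive_pair f g alpha psi ->
  (forall n, g (x n.+1) = f (x n)) ->
  (forall n, 1 <= alpha (g (x n)) (g (x n.+1))) ->
  cauchy ((fun n => g (x n)) @ \oo).
Proof.
move=> psiP contr xS alpha1.
pose a n := mdist (g (x n)) (g (x n.+1)).
apply: (cauchy_of_summable_steps (b := fun n => iter n psi (a 0))); last first.
  by apply: Psi_iter_summable => //; exact: mdist_ge0.
apply: (Psi_iter_bound (a := a)) => // n; first exact: mdist_ge0.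
rewrite /a [in leLHS]xS [in leLHS](xS n.+1).
apply: le_trans (contract_admitted contr (alpha1 n)) _.
case: psiP => _ + _; apply; first by rewrite le_max mdist_ge0.
by rewrite (xS n.+1); apply: maxdist_step.
Qed.

(** Admissibility propagates [1 <= alpha (g u) _] along the orbit because
    [g u = f u], so the distances from [g u] to the orbit are dominated by the
    iterates of [psi]. As the conclusion does not depend on how the orbit is
    linked to [u], one orbit linked to two coincidence points identifies their
    values. *)
Lemma orbit_cvg_coincidence (R : realType) (X : metricType R) (f g : X -> X)
    (alpha : X -> X -> R) (psi : R -> R) (x : nat -> X) (u : X) :
  Psi psi -> generalized_contractive_pair f g alpha psi ->
  admissible_wrt alpha f g ->
  (forall n, g (x n.+1) = f (x n)) ->
  coincidence g f u -> 1 <= alpha (g u) (g (x 0)) ->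
  (fun n => g (x n)) @ \oo --> g u.
Proof.
move=> psiP contr adm xS gfu alpha0.
have alpha1 n : 1 <= alpha (g u) (g (x n)).
  by elim: n => // n IHn; rewrite xS gfu; apply: adm.
pose a n := mdist (g u) (g (x n)).
have a_le n : a n <= iter n psi (a 0).
  apply: Psi_iter_bound => // {}n; first exact: mdist_ge0.
  rewrite /a [in leLHS]xS [in leLHS]gfu.
  apply: le_trans (contract_admitted contr (alpha1 n)) _.
  case: psiP => _ + _; apply; first by rewrite le_max mdist_ge0.
  by rewrite xS; apply: maxdist_coincidence.
apply/metricType_numDomainType.cvgrPdist_lt => e e0.
have /cvg_series_cvg_0/cvgrPdist_lt/(_ e e0) :=
  Psi_iter_summable psiP (mdist_ge0 (g u) (g (x 0))).
apply: filterS => n; rewrite sub0r normrN; apply: le_lt_trans.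
exact: le_trans (a_le n) (ler_norm _).
Qed.

(** Let [r] be the distance from [g z] to [f z]. As [g (x n)] and [f (x n)] both
    approach [g z], the only contributions to [maxdist f g (x n) z] that do not
    vanish are averages in which [r] is halved; since [psi t <= t], the
    contraction gives [r <= r / 2] up to an arbitrarily small error. The
    inequality for [alpha] is required frequently rather than eventually because
    it comes from a subsequence. *)
Lemma orbit_limit_coincidence (R : realType) (X : metricType R) (f g : X -> X)
    (alpha : X -> X -> R) (psi : R -> R) (x : nat -> X) (z : X) :
  Psi psi -> generalized_contractive_pair f g alpha psi ->
  (forall n, g (x n.+1) = f (x n)) ->
  (fun n => g (x n)) @ \oo --> g z ->
  (forall N, exists2 n, (N <= n)%N & 1 <= alpha (g (x n)) (g z)) ->
  coincidence g f z.
Proof.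
move=> psiP contr xS gxz freq; rewrite /coincidence /=.
apply: mdist_positivity; apply/eqP; rewrite eq_le mdist_ge0 andbT leNgt.
apply/negP => r0; set r := mdist (g z) (f z) in r0.
(* The errors below add up to [r <= e + (e + r / 2)], that is [r <= 4 * e]. *)
pose e := r / 8; have e0 : 0 < e by rewrite divr_gt0.
have [N _ near_z] := metricType_numDomainType.cvgr_dist_lt gxz e0.
have [n Nn alpha1] := freq N.
have zn : mdist (g z) (g (x n)) < e by exact: near_z.
have zSn : mdist (g z) (f (x n)) < e by rewrite -xS; apply/near_z/leqW.
have M_le : maxdist f g (x n) z <= e + r / 2.
  have nf := metric_triangle (g (x n)) (g z) (f (x n)).
  have nz := metric_triangle (g (x n)) (g z) (f z).
  move: nf nz; rewrite /maxdist !ge_max (metric_sym (g (x n)) (g z)) -/r => nf nz.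
  by apply/and3P; split; lra.
have M0 : 0 <= maxdist f g (x n) z by rewrite le_max mdist_ge0.
have d_le := le_trans (contract_admitted contr alpha1) (Psi_le psiP M0).
have := metric_triangle (g z) (f (x n)) (f z); rewrite -/r => tri.
by rewrite /e in zSn M_le; lra.
Qed.

(** * The common fixed point *)

Theorem theorem3p2 (R : realType) (X : metricType R) (f g : X -> X)
    (alpha : X -> X -> R) (psi : R -> R)
    (Xcomplete : complete_metric X)
    (fXgX : range f `<=` range g)
    (alpha_ge0 : forall x y, 0 <= alpha x y)
    (psiPsi : Psi psi)
    (contr : generalized_contractive_pair f g alpha psi)
    (admissible : admissible_wrt alpha f g)
    (start : exists x0 : X, 1 <= alpha (g x0) (f x0))
    (regular : forall (x : nat -> X) (z : X),
       (forall n, 1 <= alpha (g (x n)) (g (x n.+1))) ->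
       (fun n => g (x n)) @ \oo --> g z ->
       exists n_ : nat -> nat,
         increasing_seq n_ /\ forall k, 1 <= alpha (g (x (n_ k))) (g z))
    (gX_closed : closed (range g))
    (coincid_link : forall u v,
       coincidence g f u -> coincidence g f v ->
       exists w : X, 1 <= alpha (g u) (g w) /\ 1 <= alpha (g v) (g w))
    (commute_coincid : forall x, coincidence g f x -> f (g x) = g (f x)) :
  exists! z : X, f z = z /\ g z = z.
Proof.
have coincid_value u v :
    coincidence g f u -> coincidence g f v -> g u = g v.
  move=> cu cv; have [w [uw vw]] := coincid_link u v cu cv.
  have [x [x0 xS]] := jungck_orbit w fXgX; subst w.
  have gxu := orbit_cvg_coincidence psiPsi contr admissible xS cu uw.
  have gxv := orbit_cvg_coincidence psiPsi contr admissible xS cv vw.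
  exact: (cvg_unique (@metric_hausdorff _ X) gxu gxv).
(* [gX_closed] puts the limit of an orbit in the image of [g], which is what
   lets it be written [g z] and [regular] be applied. *)
have [z gfz] : exists z, coincidence g f z.
  have [x0 start0] := start.
  have [x [x00 xS]] := jungck_orbit x0 fXgX; subst x0.
  have alpha1 n : 1 <= alpha (g (x n)) (g (x n.+1)).
    elim: n => [|n IHn]; first by rewrite xS.
    by rewrite xS (xS n.+1); apply: admissible.
  have [l gxl] := Xcomplete _ (orbit_cauchy psiPsi contr xS alpha1).
  have [z _ gz] : range g l.
    by apply: (closed_cvg _ gX_closed _ _ gxl); apply: nearW => n; exists (x n).
  rewrite -gz in gxl; exists z.
  have [n_ [n_incr n_alpha]] := regular x z alpha1 gxl.
  apply: orbit_limit_coincidence psiPsi contr xS gxl _ => N.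
  by exists (n_ N); [exact: increasing_seq_ge_id | exact: n_alpha].
(* Commutation makes [g z] itself a coincidence point, hence one whose value
   under [g] is the common value [g z]. *)
have gfgz : coincidence g f (g z).
  by rewrite /coincidence /= commute_coincid// -gfz.
have ggz : g (g z) = g z by exact: coincid_value.
exists (g z); split; first by rewrite -gfgz ggz.
move=> y [fy gy]; rewrite -gy; apply: coincid_value => //.
by rewrite /coincidence /= fy gy.
Qed.
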